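(* Let $\mathbf{k}$ be a field, $\lambda\in\mathbf{k}$, and let $$\phi(x_1,x_2)=\lfloor x_1\rfloor\lfloor x_2\rfloor-\lfloor x_1\lfloor x_2\rfloor\rfloor-\lfloor\lfloor x_1\rfloor x_2\rfloor-\lambda x_1x_2$$ be the modified Rota-Baxter operated polynomial identity of weight $\lambda$. Let $Z$ be a set, let $S_\phi(Z)=\{\phi(u,v)\mid u,v\in\mathfrak{M}(Z)\}\subseteq\mathbf{k}\mathfrak{M}(Z)$, and let $$\mathfrak{R}(Z)=\mathfrak{M}(Z)\setminus\{q|_{\lfloor u\rfloor\lfloor v\rfloor}\mid u,v\in\mathfrak{M}(Z),\ q\in\mathfrak{M}^\star(Z)\}.$$ Then there is a $\mathbf{k}$-module isomorphism $\mathbf{k}\mathfrak{M}(Z)/\mathrm{Id}(S_\phi(Z))\cong\mathbf{k}\mathfrak{R}(Z)$. More precisely, $$\mathbf{k}\mathfrak{M}(Z)=\mathrm{Id}(S_\phi(Z))\oplus\mathbf{k}\mathfrak{R}(Z).$$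
   Context: For a set $Z$, $M(Z)$ denotes the free monoid on $Z$. Put $\mathfrak{M}_0(Z)=M(Z)$ and $\mathfrak{M}_n(Z)=M(Z\cup\lfloor \mathfrak{M}_{n-1}(Z)\rfloor)$ for $n\ge1$, where $\lfloor Y\rfloor=\{\lfloor u\rfloor\mid u\in Y\}$ is a disjoint copy of $Y$; with the natural embeddings, $\mathfrak{M}(Z)=\bigcup_n\mathfrak{M}_n(Z)$ is the monoid of bracketed words. It is the free monoid with a self-map $u\mapsto\lfloor u\rfloor$ on $Z$, and $\mathbf{k}\mathfrak{M}(Z)$ (the $\mathbf{k}$-span, with $\lfloor\ \rfloor$ extended linearly) is the free operated algebra on $Z$ (an associative unitary $\mathbf{k}$-algebra with a $\mathbf{k}$-linear self-map). $\mathfrak{M}^\star(Z)$ is the set of bracketed words on $Z\cup\{\star\}$ ($\star\notin Z$) containing $\star$ exactly once; for $q\in\mathfrak{M}^\star(Z)$ and $u\in\mathfrak{M}(Z)$, $q|_u$ is obtained by replacing $\star$ in $q$ by $u$. $\phi(u,v)$ is obtained from $\phi$ by substituting $u,v$ for $x_1,x_2$. For $S\subseteq\mathbf{k}\mathfrak{M}(Z)$, $\mathrm{Id}(S)$ is the operated ideal generated by $S$, i.e. the smallest two-sided ideal containing $S$ and closed under $\lfloor\ \rfloor$. $\mathbf{k}Y$ denotes the $\mathbf{k}$-span of $Y$. *)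

(* Defs.v *)
From HB Require Import structures.
From mathcomp Require Import all_boot all_order all_algebra ring_quotient.
From mathcomp Require Import finmap boolp classical_sets.
From mathcomp.multinomials Require Import monalg.

Set Implicit Arguments.
Unset Strict Implicit.
Unset Printing Implicit Defensive.

Import GRing.Theory.

Local Open Scope ring_scope.
Local Open Scope classical_set_scope.
Local Open Scope quotient_scope.

(* Bracketed words.  A word is a finite sequence of letters, and a letter is  *)
(* either a generator or a bracketed word: the inductive nesting realises the *)
(* union of the chain M_0(Z) <= M_1(Z) <= ... (a bracket of depth n has its   *)
(* content in M_(n-1)(Z)).                                                    *)
Inductive bletter (Z : Type) : Type :=
  | Var of Z
  | Br of seq (bletter Z).

Definition bword (Z : Type) : Type := seq (bletter Z).

Definition bvar (Z : Type) (z : Z) : bword Z := [:: Var z].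
Definition bbrack (Z : Type) (w : bword Z) : bword Z := [:: Br w].

(* Z is an arbitrary type, hence the classical equality and choice. *)
HB.instance Definition _ (Z : Type) := gen_eqMixin (bletter Z).
HB.instance Definition _ (Z : Type) := gen_choiceMixin (bletter Z).
HB.instance Definition _ (Z : Type) := Choice.on (bword Z).

Lemma bword_unitm (Z : Type) (u v : bword Z) :
  u ++ v = [::] -> u = [::] /\ v = [::].
Proof. by case: u. Qed.

HB.instance Definition _ (Z : Type) :=
  @Choice_isMonomialDef.Build (bword Z) [::] cat (@catA _) (@cat0s _) (@cats0 _)
    (@bword_unitm Z).

(* Simultaneous substitution of bracketed words for the generators. *)
Fixpoint lsubst (X Z : Type) (s : X -> bword Z) (l : bletter X) : bword Z :=
  match l with
  | Var x => s x
  | Br w => bbrack (flatten (map (lsubst s) w))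
  end.

Definition bsubst (X Z : Type) (s : X -> bword Z) (w : bword X) : bword Z :=
  flatten (map (lsubst s) w).

(* The symbol "star" is None : option Z. *)
Fixpoint lstars (Z : Type) (l : bletter (option Z)) : nat :=
  match l with
  | Var None => 1%N
  | Var (Some _) => 0%N
  | Br w => sumn (map (@lstars Z) w)
  end.

Definition star_word (Z : Type) : set (bword (option Z)) :=
  [set q | sumn (map (@lstars Z) q) = 1%N].

Definition plug (Z : Type) (q : bword (option Z)) (u : bword Z) : bword Z :=
  bsubst (oapp (@bvar Z) u) q.

(* The k-linear extension of a map between monomials. *)
Definition malg_map (k : fieldType) (M N : choiceType) (f : M -> N)
    (g : {malg k[M]}) : {malg k[N]} :=
  \sum_(m <- msupp g) << g@_m *g f m >>.

Section MalgMap.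
Variables (k : fieldType) (M N : choiceType) (f : M -> N).

Lemma malg_mapEw (d : {fset M}) (g : {malg k[M]}) :
  (msupp g `<=` d)%fset -> malg_map f g = \sum_(m <- d) << g@_m *g f m >>.
Proof.
move=> gd; rewrite /malg_map (big_fset_incl _ gd) //= => m _ mg.
by rewrite mcoeff_outdom // monalgU0.
Qed.

Lemma malg_map_linear : linear (@malg_map k M N f).
Proof.
move=> a x y; set d := (msupp x `|` msupp y)%fset.
have xd : (msupp x `<=` d)%fset by apply: fsubsetUl.
have yd : (msupp y `<=` d)%fset by apply: fsubsetUr.
have sd : (msupp (a *: x + y) `<=` d)%fset.
  apply: fsubset_trans (msuppD_le _ _) _.
  by apply: fsetSU; apply: msuppZ_le.
rewrite (malg_mapEw xd) (malg_mapEw yd) (malg_mapEw sd) scaler_sumr -big_split.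
apply: eq_bigr => m _ /=; apply/malgP => n.
by rewrite !(mcoeffD, mcoeffZ, mcoeffU) mulrnDl mulrnAr.
Qed.

HB.instance Definition _ :=
  GRing.isLinear.Build k {malg k[M]} {malg k[N]} _ (@malg_map k M N f)
    malg_map_linear.

Lemma malg_mapU (c : k) (m : M) : malg_map f << c *g m >> = << c *g f m >>.
Proof.
by rewrite (malg_mapEw msuppU_le) big_seq_fset1 mcoeffUU.
Qed.

End MalgMap.

(* The bracket of the free operated algebra k M(Z). *)
Definition abrack (k : fieldType) (Z : Type) :
    {malg k[bword Z]} -> {malg k[bword Z]} :=
  malg_map (@bbrack Z).

(* An operated polynomial identity phi(x_1, x_2) is an element of the free    *)
(* operated algebra on {x_1, x_2}, taken to be bool.                          *)
Definition mRB (k : fieldType) (lambda : k) : {malg k[bword bool]} :=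
  let x1 : {malg k[bword bool]} := << bvar false >> in
  let x2 : {malg k[bword bool]} := << bvar true >> in
  abrack x1 * abrack x2 - abrack (x1 * abrack x2) - abrack (abrack x1 * x2)
  - lambda *: (x1 * x2).

Definition opi_subst (k : fieldType) (Z : Type) (phi : {malg k[bword bool]})
    (u v : bword Z) : {malg k[bword Z]} :=
  malg_map (bsubst (fun b : bool => if b then v else u)) phi.

Lemma monalgUM (k : fieldType) (M : monomType) (u v : M) :
  (<< u >> : {malg k[M]}) * << v >> = << mmul u v >>.
Proof. by rewrite malgM_def fgmulUU mulr1. Qed.

Lemma mRB_subst (k : fieldType) (lambda : k) (Z : Type) (u v : bword Z) :
  let a : {malg k[bword Z]} := << u >> in
  let b : {malg k[bword Z]} := << v >> in
  opi_subst (mRB lambda) u v =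
    abrack a * abrack b - abrack (a * abrack b) - abrack (abrack a * b)
    - lambda *: (a * b).
Proof.
rewrite /= /opi_subst /mRB /abrack.
do !(rewrite malg_mapU || rewrite monalgUM).
rewrite !linearB linearZ /= !malg_mapU /= /bsubst /= !cats0.
by [].
Qed.

Definition opi_instances (k : fieldType) (Z : Type)
    (phi : {malg k[bword bool]}) : set {malg k[bword Z]} :=
  [set opi_subst phi u v | u in [set: bword Z] & v in [set: bword Z]].

Definition operated_ideal (k : fieldType) (Z : Type)
    (I : set {malg k[bword Z]}) : Prop :=
  [/\ I 0,
      forall x y, I x -> I y -> I (x - y),
      forall a x, I x -> I (a * x) /\ I (x * a) &
      forall x, I x -> I (abrack x)].

Definition opideal (k : fieldType) (Z : Type) (S : set {malg k[bword Z]}) :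
    {pred {malg k[bword Z]}} :=
  fun x => `[< smallest (@operated_ideal k Z) S x >].

Lemma opideal_submod_closed (k : fieldType) (Z : Type)
  (S : set {malg k[bword Z]}) : submod_closed (opideal S).
Proof.
split=> [|a x y /asboolP Ix /asboolP Iy]; apply/asboolP=> J [idJ SJ].
  by case: idJ.
have [J0 JB JM _] := idJ.
have Jx := Ix J (conj idJ SJ); have Jy := Iy J (conj idJ SJ).
rewrite -mul_malgC -[y]opprK; apply: (JB); first by case: (JM a%:MP x Jx).
by rewrite -sub0r; apply: JB.
Qed.

HB.instance Definition _ (k : fieldType) (Z : Type)
    (S : set {malg k[bword Z]}) :=
  GRing.isSubmodClosed.Build k {malg k[bword Z]} (opideal S)
    (opideal_submod_closed S).

Definition submodule (k : fieldType) (V : lmodType k) (A : set V) : Prop :=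
  A 0 /\ forall (a : k) (x y : V), A x -> A y -> A (a *: x + y).

Definition lspan (k : fieldType) (V : lmodType k) (X : set V) : {pred V} :=
  fun x => `[< smallest (@submodule k V) X x >].

Lemma lspan_submod_closed (k : fieldType) (V : lmodType k) (X : set V) :
  submod_closed (lspan X).
Proof.
split=> [|a x y /asboolP Ax /asboolP Ay]; apply/asboolP=> J [smJ XJ].
  by case: smJ.
have [J0 JL] := smJ.
by apply: JL; [exact: (Ax J (conj smJ XJ)) | exact: (Ay J (conj smJ XJ))].
Qed.

HB.instance Definition _ (k : fieldType) (V : lmodType k) (X : set V) :=
  GRing.isSubmodClosed.Build k V (lspan X) (lspan_submod_closed X).

Definition kspan (k : fieldType) (Z : Type) (Y : set (bword Z)) :
    {pred {malg k[bword Z]}} :=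
  lspan [set (<< w >> : {malg k[bword Z]}) | w in Y].

Arguments kspan k {Z} Y.

HB.instance Definition _ (k : fieldType) (Z : Type) (Y : set (bword Z)) :=
  GRing.SubmodClosed.on (kspan k Y).

Section SubmodType.
Variables (k : fieldType) (V : lmodType k) (P : submodClosed V).

Record submod_type : predArgType :=
  Submod { submod_val : V; submod_valP : submod_val \in P }.

HB.instance Definition _ := [isSub for submod_val].
HB.instance Definition _ := [Choice of submod_type by <:].
HB.instance Definition _ := [SubChoice_isSubLmodule of submod_type by <:].

End SubmodType.

(* The library only has quotients of Z-modules, by a zmodClosed predicate:    *)
(* submodClosed does not provide closure under opposite, and the quotient     *)
(* carries no scalar action.                                                  *)
Definition zmod_of (k : fieldType) (V : lmodType k) (P : submodClosed V) :
  {pred V} := fun x => x \in P.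

Lemma zmod_of_closed (k : fieldType) (V : lmodType k) (P : submodClosed V) :
  zmod_closed (zmod_of P).
Proof.
split=> [|x y Px Py]; first exact: rpred0.
by apply: rpredD => //; rewrite -scaleN1r; apply: rpredZ.
Qed.

HB.instance Definition _ (k : fieldType) (V : lmodType k)
    (P : submodClosed V) :=
  GRing.isZmodClosed.Build V (zmod_of P) (zmod_of_closed P).

Definition quot_lmod (k : fieldType) (V : lmodType k) (P : submodClosed V) :
  Type := Quotient.quot (zmod_of P).

Section QuotLmod.
Variables (k : fieldType) (V : lmodType k) (P : submodClosed V).
Local Notation Q := (quot_lmod P).

HB.instance Definition _ :=
  ZmodQuotient.copy Q (Quotient.quot (zmod_of P)).

Definition quot_scale (a : k) : Q -> Q := lift_op1 Q ( *:%R a).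

Lemma pi_scale (a : k) : {morph \pi_Q : x / a *: x >-> quot_scale a x}.
Proof.
move=> x; unlock quot_scale; apply/eqP.
rewrite -(Quotient.idealrBE (zmod_of P)) -scalerBr.
apply: (@rpredZ _ _ P); change (x - repr (\pi_Q x) \in zmod_of P).
by rewrite Quotient.idealrBE reprK.
Qed.

Lemma quot_scaleA (a b : k) (x : Q) :
  quot_scale a (quot_scale b x) = quot_scale (a * b) x.
Proof. by elim/quotW: x => x; rewrite -!pi_scale scalerA. Qed.

Lemma quot_scale1 : left_id 1 quot_scale.
Proof. by elim/quotW=> x; rewrite -pi_scale scale1r. Qed.

Lemma quot_scaleDr : right_distributive quot_scale +%R.
Proof.
move=> a; elim/quotW=> x; elim/quotW=> y.
by rewrite -!pi_scale -!raddfD /= -pi_scale scalerDr.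
Qed.

Lemma quot_scaleDl (x : Q) : {morph quot_scale^~ x : a b / a + b}.
Proof.
by elim/quotW: x => x a b /=; rewrite -!pi_scale scalerDl raddfD.
Qed.

HB.instance Definition _ := GRing.Zmodule_isLmodule.Build k Q
  quot_scaleA quot_scale1 quot_scaleDr quot_scaleDl.

End QuotLmod.

Definition lmod_isomorphic (k : fieldType) (U V : lmodType k) : Prop :=
  exists f : {linear U -> V}, bijective f.

Definition internal_direct_sum (k : fieldType) (V : lmodType k)
    (P Q : submodClosed V) : Prop :=
  (forall x : V, exists2 a, a \in P & exists2 b, b \in Q & x = a + b) /\
  (forall x : V, x \in P -> x \in Q -> x = 0).

Definition mRB_reducible (Z : Type) : set (bword Z) :=
  [set w | exists (u v : bword Z) (q : bword (option Z)),
     star_word q /\ w = plug q (bbrack u ++ bbrack v)].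

Definition mRB_irr (Z : Type) : set (bword Z) := ~` @mRB_reducible Z.

(* Main.v *)
(* Orient the identity as the rewriting rule                                  *)
(*   [x][y] -> [x[y]] + [[x]y] + lambda xy  =: rb x y.                        *)
(* Every term on the right has fewer letters (generators and brackets) than   *)
(* the left-hand side, or as many but fewer at top level, so rewriting the    *)
(* leftmost outermost redex terminates and defines a linear normal form map   *)
(* nf onto the span of the irreducible words, with x - nf x in the ideal.  It *)
(* remains to see that nf kills the ideal, which follows from its             *)
(* compatibility with products: nf (nf x * y) = nf (x * y) holds              *)
(* because the strategy works from the left, and nf (x * nf y) = nf (x * y)   *)
(* reduces to the resolution of the single overlap [x][y][z].  Hence ker nf   *)
(* is an operated ideal containing the instances of the identity, so it is    *)
(* the whole ideal and nf is the projection along it.                         *)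

Require Import Defs.
From HB Require Import structures.
From mathcomp Require Import all_boot all_order all_algebra ring_quotient.
From mathcomp Require Import finmap boolp classical_sets zify.
From mathcomp.multinomials Require Import monalg.

Set Implicit Arguments.
Unset Strict Implicit.
Unset Printing Implicit Defensive.

Import GRing.Theory.

Local Open Scope ring_scope.

(** A word is irreducible when no two brackets are adjacent at any depth, and [nf] is a linear
    retraction of the algebra onto the span of these words ([nf_irr], [nf_id]). Each rewriting step
    changes an element by a member of the ideal, hence [x - nf x] lies in it ([sub_nf]) and the two
    summands span. They meet in [0] because [nf] kills the ideal ([nf_opideal]) and fixes
    irreducible words.

    That [nf] kills the ideal is the confluence of the rewriting system. It amounts to: normalising
    a factor first does not change the normal form of a product. For a left factor ([N_mull]) this
    is an induction on words. For a right factor ([N_mulr]) a redex [[y][z]] must be rewritable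
    behind any prefix ([N_mulrb]), and a conflict arises only when the prefix ends with a bracket;
    both reductions of [[x][y][z]] then yield the same terms ([N_overlap]). *)

Section Words.
Variable Z : Type.
Implicit Types (u v w : bword Z).

(** * Induction on bracketed words and the termination order *)

Lemma bword_ind (P : bword Z -> Prop) :
  P [::] -> (forall z w, P w -> P (Var z :: w)) ->
  (forall u w, P u -> P w -> P (Br u :: w)) -> forall w, P w.
Proof.
move=> P0 PV PB.
have cons (l : bletter Z) : forall w, P w -> P (l :: w).
  (* The type is nested: the recursion on letters runs inside a list induction over the content of
     the bracket. *)
  move: l; fix IH 1 => -[z|u] w Pw; first exact: PV.
  apply: PB => //; elim: u => [|l u Pu] //; exact: IH.
by elim=> [|l w Pw] //; exact: cons.
Qed.

Fixpoint letter_weight (l : bletter Z) : nat :=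
  if l is Br w then (sumn (map letter_weight w)).+1 else 1%N.

Definition weight w : nat := sumn (map letter_weight w).

Lemma weight_cat u v : weight (u ++ v) = (weight u + weight v)%N.
Proof. by rewrite /weight map_cat sumn_cat. Qed.

Lemma weight_Var z w : weight (Var z :: w) = (weight w).+1.
Proof. by []. Qed.

Lemma weight_Br u w : weight (Br u :: w) = (weight u + weight w).+1.
Proof. by []. Qed.

Lemma weight_brack w : weight (bbrack w) = (weight w).+1.
Proof. by rewrite weight_Br addn0. Qed.

Definition weightE := (weight_cat, weight_Var, weight_brack, weight_Br).

Lemma size_weight w : (size w <= weight w)%N.
Proof. by elim: w => // -[z|u] w IH; rewrite weightE /=; lia. Qed.

(* As size w <= weight w, this encodes the lexicographic order on the pairs   *)
(* (weight w, size w).                                                        *)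
Definition rank w : nat := (weight w * (weight w).+1 + size w)%N.

Lemma ltn_rank u v :
  (weight u < weight v)%N || (weight u == weight v) && (size u < size v)%N ->
  (rank u < rank v)%N.
Proof. by have := size_weight u; have := size_weight v; rewrite /rank; nia. Qed.

Definition head_bracket w := if w is Br _ :: _ then true else false.

Definition no_head_bracket : set (bword Z) := [set w | ~~ head_bracket w].

(** Well-founded induction on [rank], with one case per branch of the leftmost outermost strategy; a
    leading redex gives one hypothesis per term of its right-hand side. *)
Lemma rewriting_ind (P : bword Z -> Prop) :
  P [::] -> (forall z w, P w -> P (Var z :: w)) ->
  (forall u w, ~~ head_bracket w -> P u -> P w -> P (Br u :: w)) ->
  (forall u v w, P (Br (u ++ bbrack v) :: w) -> P (Br (Br u :: v) :: w) ->
     P (u ++ v ++ w) -> P (Br u :: Br v :: w)) ->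
  forall w, P w.
Proof.
move=> P0 PV PB PBB w; have [n] := ubnP (rank w).
elim: n w => // n IH w; rewrite ltnS => le_n.
have {}IH v : (rank v < rank w)%N -> P v.
  by move=> lt_v; apply: IH; exact: leq_trans lt_v le_n.
case: w IH {le_n} => [|[z|u] w] IH //.
  by apply: PV; apply: IH; apply: ltn_rank; rewrite weightE /=; lia.
case: (boolP (head_bracket w)) => [|hw]; last first.
  by apply: PB => //; apply: IH; apply: ltn_rank; rewrite weightE /=; lia.
case: w IH => [|[//|v] w] // IH _; apply: PBB; apply: IH; apply: ltn_rank;
  by rewrite !weightE /=; lia.
Qed.

(** * Recursive description of the irreducible words *)

Definition lift_word w : bword (option Z) := bsubst (fun z => bvar (Some z)) w.

Lemma stars_lift w : sumn (map (@lstars Z) (lift_word w)) = 0%N.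
Proof.
elim/bword_ind: w => // u w /=.
by rewrite /lift_word /bsubst /= => -> ->.
Qed.

Lemma plug_lift w u : plug (lift_word w) u = w.
Proof.
elim/bword_ind: w => [|z w IH|v w IHv IHw] //.
- by rewrite -[in RHS]IH.
- by rewrite -[in RHS]IHv -[in RHS]IHw.
Qed.

Lemma reducible_Var z w : mRB_reducible (Var z :: w) <-> mRB_reducible w.
Proof.
split=> [[u [v [[|[[y|]|q1] q] [sq]]]] //|[u [v [q [sq ->]]]]].
- by move=> [_ ->]; exists u, v, q.
- by exists u, v, (Var (Some z) :: q).
Qed.

(** A redex of [[u]w] lies inside [u], inside [w], or is made of the first two letters. *)
Lemma reducible_Br u w :
  mRB_reducible (Br u :: w) <->
  [\/ mRB_reducible u, mRB_reducible w | head_bracket w].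
Proof.
split=> [[u1 [v1 [[|[[y|]|q1] q] [sq]]]] //|].
- by case=> _ ->; apply: Or33.
- case=> -> ->; move: sq; rewrite /star_word /= => sq.
  (* The star is unique, so it lies either in the first bracket or in the tail of the context. *)
  have [/eqP s1|s1] := boolP (sumn (map (@lstars Z) q1) == 1%N).
    by apply: Or31; exists u1, v1, q1.
  by apply: Or32; exists u1, v1, q; split=> //; rewrite /star_word /=; lia.
case=> [[u1 [v1 [q [sq ->]]]]|[u1 [v1 [q [sq ->]]]]|].
- exists u1, v1, (Br q :: lift_word w); split.
    by rewrite /star_word /= stars_lift addn0.
  by rewrite -[in LHS](plug_lift w (bbrack u1 ++ bbrack v1)).
- exists u1, v1, (Br (lift_word u) :: q); split.
    by rewrite /star_word /= stars_lift.
  by rewrite -[in LHS](plug_lift u (bbrack u1 ++ bbrack v1)).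
- case: w => [|[//|v] w] // _; exists u, v, (Var None :: lift_word w); split.
    by rewrite /star_word /= stars_lift.
  by rewrite -[in LHS](plug_lift w (bbrack u ++ bbrack v)).
Qed.

Lemma irr_nil : mRB_irr ([::] : bword Z).
Proof. by move=> [u [v [[|[[y|]|q1] q] []]]]. Qed.

Lemma irr_Var z w : mRB_irr (Var z :: w) <-> mRB_irr w.
Proof. by rewrite /mRB_irr /setC /= reducible_Var. Qed.

Lemma irr_Br u w :
  mRB_irr (Br u :: w) <-> [/\ mRB_irr u, mRB_irr w & ~~ head_bracket w].
Proof.
rewrite /mRB_irr /setC /= reducible_Br; split=> [h|[hu hw hh] []//].
  by split; first [move=> ?; by [apply/h/Or31|apply/h/Or32]
                  |by apply/negP=> ?; apply/h/Or33].
by apply/negP.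
Qed.

End Words.

(** * Closure rules for linearity, linear extension, and spans of words *)

Section LinearMaps.
Variables (k : fieldType) (U V W : lmodType k).

Lemma linear_add (f g : U -> V) :
  linear f -> linear g -> linear (fun x => f x + g x).
Proof. by move=> Lf Lg c x y; rewrite Lf Lg scalerDr addrACA. Qed.

Lemma linear_scale (a : k) (f : U -> V) :
  linear f -> linear (fun x => a *: f x).
Proof. by move=> Lf c x y; rewrite Lf scalerDr !scalerA mulrC. Qed.

Lemma linear_comp (g : {linear V -> W}) (f : U -> V) :
  linear f -> linear (fun x => g (f x)).
Proof. by move=> Lf c x y; rewrite Lf linearP. Qed.

End LinearMaps.

Lemma linear_mulr (k : fieldType) (U : lmodType k) (A : lalgType k) (x : A)
    (f : U -> A) :
  linear f -> linear (fun t => f t * x).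
Proof. by move=> Lf c y z; rewrite Lf mulrDl scalerAl. Qed.

Lemma linear_id (k : fieldType) (U : lmodType k) : linear (fun x : U => x).
Proof. by []. Qed.

Section MonoidAlgebra.
Variables (k : fieldType) (M : monomType).
Local Notation A := {malg k[M]}.

Lemma malg_scalerAr (c : k) (x y : A) : c *: (x * y) = x * (c *: y).
Proof.
rewrite -!mul_malgC !mulrA; congr (_ * _).
rewrite !malgM_def fgmulUg fgmulgU; apply: eq_bigr => m _.
by rewrite mul1m mulm1 mulrC.
Qed.

End MonoidAlgebra.

Section LinearExtension.
Variables (k : fieldType) (M : choiceType) (V : lmodType k) (h : M -> V).

Definition malg_lift (x : {malg k[M]}) : V := \sum_(m <- msupp x) x@_m *: h m.

Lemma malg_liftEw (d : {fset M}) x :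
  (msupp x `<=` d)%fset -> malg_lift x = \sum_(m <- d) x@_m *: h m.
Proof.
move=> xd; rewrite /malg_lift (big_fset_incl _ xd) //= => m _ mx.
by rewrite mcoeff_outdom // scale0r.
Qed.

Lemma malg_lift_linear : linear malg_lift.
Proof.
move=> a x y; pose d := (msupp x `|` msupp y `|` msupp (a *: x + y))%fset.
rewrite !(@malg_liftEw d); first last.
- exact: fsubsetUr.
- by apply/fsubsetP=> m mx; rewrite !inE mx.
- by apply/fsubsetP=> m my; rewrite !inE my orbT.
rewrite scaler_sumr -big_split; apply: eq_bigr => m _ /=.
by rewrite mcoeffD mcoeffZ scalerDl scalerA.
Qed.

HB.instance Definition _ :=
  GRing.isLinear.Build k {malg k[M]} V _ malg_lift malg_lift_linear.

Lemma malg_liftU m : malg_lift << m >> = h m.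
Proof. by rewrite (malg_liftEw msuppU_le) big_seq_fset1 mcoeffUU scale1r. Qed.

End LinearExtension.

Section Spans.
Variables (k : fieldType) (Z : Type).
Local Notation A := {malg k[bword Z]}.
Implicit Types (Y : set (bword Z)) (w : bword Z) (x y : A).

Lemma kspan_word Y w : Y w -> << w >> \in kspan k Y.
Proof. by move=> Yw; apply/asboolP=> J [_]; apply; exists w. Qed.

Lemma kspan_ind Y (P : A -> Prop) :
  P 0 -> (forall a x y, P x -> P y -> P (a *: x + y)) ->
  (forall w, Y w -> P << w >>) -> forall x, x \in kspan k Y -> P x.
Proof. by move=> P0 PD PY x /asboolP; apply; split=> // _ [w Yw <-]; exact: PY. Qed.

Lemma mem_kspanT x : x \in kspan k [set: bword Z].
Proof.
rewrite [x]monalgE; apply: rpred_sum => w _.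
have -> : << x@_w *g w >> = x@_w *: << w >> :> A.
  by apply/malgP=> v; rewrite mcoeffZ !mcoeffU mulr_natr.
by apply: rpredZ; exact: kspan_word.
Qed.

Lemma kspan_linear_eq Y (V : lmodType k) (f g : A -> V) :
  linear f -> linear g -> (forall w, Y w -> f << w >> = g << w >>) ->
  forall x, x \in kspan k Y -> f x = g x.
Proof.
move=> Lf Lg fg; apply: kspan_ind => //.
(* Writing [0] as [-1 *: 0 + 0] extracts the value at [0] from bare linearity. *)
- by rewrite -[0](subrr 0) -scaleN1r addrC Lf Lg !scaleN1r !addNr.
- by move=> a x y fx fy; rewrite Lf Lg fx fy.
Qed.

Lemma malg_linear_eq (V : lmodType k) (f g : A -> V) :
  linear f -> linear g -> (forall w, f << w >> = g << w >>) -> f =1 g.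
Proof. by move=> Lf Lg fg x; apply: (kspan_linear_eq Lf Lg _ (mem_kspanT x)). Qed.

Lemma kspan_linear_mem Y (V : lmodType k) (P : submodClosed V) (f : A -> V) :
  linear f -> (forall w, Y w -> f << w >> \in P) ->
  forall x, x \in kspan k Y -> f x \in P.
Proof.
move=> Lf fP; apply: kspan_ind => //.
- by rewrite -[0](subrr 0) -scaleN1r addrC Lf scaleN1r addNr rpred0.
- by move=> a x y fx fy; rewrite Lf rpredD // rpredZ.
Qed.

Lemma kspanS Y1 Y2 : (forall w, Y1 w -> Y2 w) ->
  forall x, x \in kspan k Y1 -> x \in kspan k Y2.
Proof.
move=> Y12 x; apply: (@kspan_linear_mem _ _ _ id) => // w /Y12.
exact: kspan_word.
Qed.

Lemma brackU w : abrack << w >> = << bbrack w >> :> A.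
Proof. exact: malg_mapU. Qed.

Lemma Var_consU z w : << Var z :: w >> = (<< bvar z >> : A) * << w >>.
Proof. by rewrite monalgUM. Qed.

Lemma Br_consU u w : << Br u :: w >> = abrack << u >> * << w >> :> A.
Proof. by rewrite brackU monalgUM. Qed.

Lemma malg_linear_mull (U : lmodType k) (x : A) (f : U -> A) :
  linear f -> linear (fun t => x * f t).
Proof. by move=> Lf c y z; rewrite Lf mulrDr malg_scalerAr. Qed.

Lemma kspan_mul Y1 Y2 Y x y :
  (forall u v, Y1 u -> Y2 v -> Y (u ++ v)) ->
  x \in kspan k Y1 -> y \in kspan k Y2 -> x * y \in kspan k Y.
Proof.
move=> Y12 xY yY; move: x xY; apply: kspan_linear_mem => [|u uY].
  exact/linear_mulr/linear_id.
move: y yY; apply: kspan_linear_mem => [|v vY].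
  exact/malg_linear_mull/linear_id.
by rewrite monalgUM; apply: kspan_word; apply: Y12.
Qed.

Lemma kspan_brack Y1 Y x : (forall u, Y1 u -> Y (bbrack u)) ->
  x \in kspan k Y1 -> abrack x \in kspan k Y.
Proof.
move=> Y1Y; apply: kspan_linear_mem => [|u uY]; first exact/linear_comp/linear_id.
by rewrite brackU; apply: kspan_word; apply: Y1Y.
Qed.

End Spans.

(** * Confluence, in an abstract algebra *)

Definition rb (k : fieldType) (A : lalgType k) (lambda : k) (B : A -> A)
    (x y : A) : A :=
  B (x * B y) + B (B x * y) + lambda *: (x * y).

(* A stands for k M(Z), B for its bracket, e for the embedding of the words,  *)
(* W n for the span of the words of weight at most n, H for the span of the   *)
(* words that do not begin with a bracket, and N for the normal form map.     *)
(* The algebra is abstract because in the concrete one a failing unification  *)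
(* unfolds the products.                                                      *)
Section Confluence.
Variables (k : fieldType) (lambda : k) (Z : Type) (A : lalgType k).
Variables (B N : {linear A -> A}) (e : bword Z -> A) (X : Z -> A).
Variables (W : nat -> {pred A}) (H : {pred A}).
Implicit Types (p u v w : bword Z) (x y z : A).

Local Notation rb := (rb lambda B).

Hypotheses
  (scalerAr : forall (c : k) x y, c *: (x * y) = x * (c *: y))
  (e_nil : e [::] = 1) (e_cat : forall u v, e (u ++ v) = e u * e v)
  (e_var : forall a, e (bvar a) = X a)
  (e_brack : forall u, e (bbrack u) = B (e u))
  (e_linear_eq : forall f g : A -> A, linear f -> linear g ->
     (forall w, f (e w) = g (e w)) -> f =1 g)
  (W_word : forall n w, (weight w <= n)%N -> e w \in W n)
  (W_linear_eq : forall n (f g : A -> A), linear f -> linear g ->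
     (forall w, (weight w <= n)%N -> f (e w) = g (e w)) ->
     forall x, x \in W n -> f x = g x)
  (H1 : 1 \in H) (HVar : forall a x, X a * x \in H).

Hypotheses
  (N1 : N 1 = 1) (NVar : forall a x, N (X a * x) = X a * N x)
  (NBr : forall x y, y \in H -> N (B x * y) = B (N x) * N y)
  (Nrb : forall x y z, N (B x * B y * z) = N (rb x y * z))
  (N_weight : forall w, N (e w) \in W (weight w)).

Lemma e_Var a w : e (Var a :: w) = X a * e w.
Proof. by rewrite -e_var -e_cat. Qed.

Lemma e_Br u w : e (Br u :: w) = B (e u) * e w.
Proof. by rewrite -e_brack -e_cat. Qed.

Definition eE := (e_nil, e_brack, e_cat, e_Var, e_Br, mulr1).

Lemma H_word w : ~~ head_bracket w -> e w \in H.
Proof. by case: w => [_|[a|u] w // _]; rewrite ?e_nil ?e_Var. Qed.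

Lemma N_B x : N (B x) = B (N x).
Proof. by rewrite -[B x]mulr1 NBr // N1 mulr1. Qed.

Lemma NrbD x y z :
  N (B x * B y * z) =
    N (B (x * B y) * z) + N (B (B x * y) * z) + lambda *: N (x * y * z).
Proof. by rewrite Nrb /rb !mulrDl -scalerAl !linearD linearZ. Qed.

Lemma linear_mull (U : lmodType k) x (f : U -> A) :
  linear f -> linear (fun t => x * f t).
Proof. by move=> Lf c y z; rewrite Lf mulrDr scalerAr. Qed.

(** Induction on the rank of [u ++ v]. A leading redex of [u] is the one rewritten in [u ++ v] too;
    the delicate case is [u] a single bracket followed by a bracket of [v], where the product
    creates a redex. *)
Lemma N_mull_word u v : N (N (e u) * e v) = N (e u * e v).
Proof.
have [n] := ubnP (rank (u ++ v)); elim: n u v => [|n IH] u v.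
  by rewrite ltn0.
rewrite ltnS => le_n.
have {le_n}IH p w :
    (weight p + weight w < weight u + weight v)%N
    || (weight p + weight w == weight u + weight v)%N
       && (size p + size w < size u + size v)%N ->
    N (N (e p) * e w) = N (e p * e w).
  move=> lt; apply: IH; apply: leq_trans le_n.
  by apply: ltn_rank; rewrite !weightE !size_cat.
case: u IH => [|[a|u] w] IH.
- by rewrite e_nil N1.
- rewrite e_Var NVar -!mulrA !NVar IH //.
  by rewrite !weightE /=; lia.
have NK p : (weight p < weight (Br u :: w) + weight v)%N -> N (N (e p)) = N (e p).
  move=> lt; have := IH p [::]; rewrite e_nil !mulr1; apply.
  by rewrite addn0 lt.
have Nu : N (N (e u)) = N (e u) by apply: NK; rewrite weightE; lia.
case: w NK IH => [|[a|u'] w] NK IH.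
- case: v NK IH => [|[a|v'] v] NK IH.
  + by rewrite !eE !N_B Nu.
  + by rewrite !eE N_B !NBr ?Nu.
  rewrite !eE N_B.
  (* Both [e u] and [N (e u)] must be substituted for [x], and the latter is a combination of words;
     [N_weight] bounds their weight by that of [u], which keeps them within reach of the induction
     hypothesis. *)
  have key x : x \in W (weight u) ->
      N (B x * (B (e v') * e v)) =
        N (B (N (x * B (e v'))) * e v) + N (B (N (B x * e v')) * e v)
        + lambda *: N (N x * (e v' * e v)).
    move: x; apply: W_linear_eq => [||p le_p].
    * exact/linear_comp/linear_mulr/linear_comp/linear_id.
    * apply/linear_add; first apply/linear_add.
      - exact/linear_comp/linear_mulr/linear_comp/linear_comp/linear_mulr/
          linear_id.
      - exact/linear_comp/linear_mulr/linear_comp/linear_comp/linear_mulr/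
          linear_comp/linear_id.
      - exact/linear_scale/linear_comp/linear_mulr/linear_comp/linear_id.
    rewrite mulrA NrbD -!N_B; congr (_ + _ + _ *: _).
    * have := IH (bbrack (p ++ bbrack v')) v; rewrite !eE => ->//.
      by rewrite !weightE /=; lia.
    * have := IH (bbrack (Br p :: v')) v; rewrite !eE => ->//.
      by rewrite !weightE /=; lia.
    * have := IH p (v' ++ v); rewrite !eE => ->; rewrite ?mulrA //.
      by rewrite !weightE /=; lia.
  rewrite !key ?W_word // Nu; congr (N (B _ * _) + N (B _ * _) + _).
  + by have := IH u (bbrack v'); rewrite !eE => ->//; rewrite !weightE /=; lia.
  + by have := IH (bbrack u) v'; rewrite !eE N_B => ->//; rewrite !weightE /=; lia.
- have := IH (Var a :: w) v; rewrite !eE -!mulrA !NBr // NVar -!mulrA NBr // Nu.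
  by move=> ->//; rewrite !weightE /=; lia.
- have -> : e [:: Br u, Br u' & w] * e v = B (e u) * B (e u') * (e w * e v).
    by rewrite !eE !mulrA.
  rewrite !e_Br mulrA !NrbD !mulrDl -scalerAl !linearD linearZ.
  congr (_ + _ + _ *: _).
  + have := IH (Br (u ++ bbrack u') :: w) v; rewrite !eE !mulrA => ->//.
    by rewrite !weightE /=; lia.
  + have := IH (Br (Br u :: u') :: w) v; rewrite !eE !mulrA => ->//.
    by rewrite !weightE /=; lia.
  + have := IH (u ++ u' ++ w) v; rewrite !eE !mulrA => ->//.
    by rewrite !weightE /=; lia.
Qed.

Lemma N_mull x y : N (N x * y) = N (x * y).
Proof.
move: x; apply: e_linear_eq => [||u].
- exact/linear_comp/linear_mulr/linear_comp/linear_id.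
- exact/linear_comp/linear_mulr/linear_id.
move: y; apply: e_linear_eq => [||v].
- exact/linear_comp/linear_mull/linear_id.
- exact/linear_comp/linear_mull/linear_id.
exact: N_mull_word.
Qed.

Lemma NK x : N (N x) = N x.
Proof. by rewrite -[N x]mulr1 N_mull !mulr1. Qed.

Lemma NrbD1 x y :
  N (B x * B y) = B (N (x * B y)) + B (N (B x * y)) + lambda *: N (x * y).
Proof. by rewrite -[B x * B y]mulr1 NrbD !mulr1 !N_B. Qed.

(* The overlap [x][y][z] is the only ambiguity of the rewriting system. *)
Lemma N_overlap x y z :
  N (x * (B y * B z)) = N (x * rb y z) ->
  N (B x * (B y * B z)) = N (B x * rb y z).
Proof.
move=> Nx; rewrite mulrA NrbD !NrbD1 -[x * B y * B z]mulrA Nx.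
rewrite /rb !mulrDr -!scalerAr !linearD !linearZ /= !NrbD1.
rewrite !mulrA NrbD !linearD !linearZ /= !addrA.
(* Both reductions have reached the same nine terms, up to order. *)
by rewrite [LHS](ACl (1*6*9*2*4*7*3*5*8)).
Qed.

(** A redex may be rewritten behind any prefix, although the strategy works from the left. Only a
    prefix reduced to a single bracket interacts with the redex, and [N_overlap] settles it, using
    the induction hypothesis for the content of that bracket. *)
Lemma N_mulrb x y z : N (x * (B y * B z)) = N (x * rb y z).
Proof.
move: x; apply: e_linear_eq => [||w].
- exact/linear_comp/linear_mulr/linear_id.
- exact/linear_comp/linear_mulr/linear_id.
elim/rewriting_ind: w => [|a w IH|u w hw IHu IHw|u v w IH1 IH2 IH3].
- by rewrite !eE !mul1r -[B y * B z]mulr1 Nrb mulr1.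
- by rewrite !eE -!mulrA !NVar IH.
- case: w hw IHw => [|[a|//] w] hw IHw; first by rewrite !eE; exact: N_overlap.
  by rewrite !e_Br -!mulrA !NBr ?IHw // e_Var -mulrA.
- rewrite !e_Br -!mulrA !(mulrA (B _) (B _)) !NrbD.
  move: IH1 IH2 IH3; rewrite !eE -!mulrA => -> -> ->//.
Qed.

(** This carries [N_mulr] through one bracket. The premise is needed for every [z]: rewriting
    [[u][y]] frees [y] behind both [[u]] and [u]. *)
Lemma N_mulr_brack x y :
  (forall z, N (z * N y) = N (z * y)) -> N (x * B (N y)) = N (x * B y).
Proof.
move=> Ny; move: x; apply: e_linear_eq => [||w].
- exact/linear_comp/linear_mulr/linear_id.
- exact/linear_comp/linear_mulr/linear_id.
elim/rewriting_ind: w => [|a w IH|u w hw IHu IHw|u v w IH1 IH2 IH3].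
- by rewrite !eE !mul1r !N_B NK.
- by rewrite !eE -!mulrA !NVar IH.
- case: w hw IHw => [|[a|//] w] hw IHw; last first.
    by rewrite !e_Br -!mulrA !NBr ?IHw // e_Var -mulrA.
  rewrite !eE -[_ * B (N y)]mulr1 -[_ * B y]mulr1 !NrbD !mulr1.
  by rewrite !N_B IHu !Ny.
- rewrite !e_Br -!mulrA !(mulrA (B _) (B _)) !NrbD.
  move: IH1 IH2 IH3; rewrite !eE -!mulrA => -> -> ->//.
Qed.

Lemma N_mulr x y : N (x * N y) = N (x * y).
Proof.
move: y; apply: e_linear_eq => [||w].
- exact/linear_comp/linear_mull/linear_comp/linear_id.
- exact/linear_comp/linear_mull/linear_id.
elim/rewriting_ind: w x => [|a w IH|u w hw IHu IHw|u v w IH1 IH2 IH3] x.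
- by rewrite !eE N1 mulr1.
- by rewrite !eE NVar !mulrA IH.
(* [N_mull] isolates the left factor [x * B (N (e u))], so that [N_mulr_brack] applies to it
   alone. *)
- by rewrite !eE NBr ?H_word // !mulrA -N_mull N_mulr_brack // N_mull IHw.
- rewrite !e_Br mulrA Nrb [in RHS]mulrA -[RHS]N_mull N_mulrb N_mull -mulrA.
  rewrite /rb !mulrDl -scalerAl !linearD linearZ !mulrDr -!scalerAr.
  rewrite !linearD !linearZ.
  by move: (IH1 x) (IH2 x) (IH3 x); rewrite !eE -!mulrA => -> -> ->.
Qed.

Lemma N_mul x y : N (N x * y) = N (x * y) /\ N (x * N y) = N (x * y).
Proof. by split; [exact: N_mull|exact: N_mulr]. Qed.

End Confluence.

(** * Construction of the normal form map *)

Section NormalWord.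
Variables (k : fieldType) (lambda : k) (Z : Type).
Local Notation A := {malg k[bword Z]}.
Implicit Types (u v w : bword Z) (x y z : A).

(** The recursion is not structural, hence the fuel. The default [0] is never reached from
    [nf_word]: every recursive call lowers [rank], which stays below the fuel. *)
Fixpoint nf_fuel (n : nat) w : A :=
  if n is m.+1 then
    match w with
    | [::] => 1
    | Var z :: w' => << bvar z >> * nf_fuel m w'
    | Br u :: Br v :: w' =>
        nf_fuel m (Br (u ++ bbrack v) :: w') + nf_fuel m (Br (Br u :: v) :: w')
        + lambda *: nf_fuel m (u ++ v ++ w')
    | Br u :: w' => abrack (nf_fuel m u) * nf_fuel m w'
    end
  else 0.

Definition nf_word w : A := nf_fuel (rank w).+1 w.

Lemma nf_fuel_indep n m w :
  (rank w < n)%N -> (rank w < m)%N -> nf_fuel n w = nf_fuel m w.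
Proof.
elim: n m w => [//|n IH] [//|m] w; rewrite !ltnS => le_n le_m.
have {}IH v : (rank v < rank w)%N -> nf_fuel n v = nf_fuel m v.
  by move=> lt_v; apply: IH; apply: leq_trans lt_v _.
case: w IH {le_m le_n} => [//|[z|u] w] IH /=.
  by rewrite IH //; apply: ltn_rank; rewrite weightE /=; lia.
case: w IH => [|[z|v] w] IH; rewrite !IH //; apply: ltn_rank;
  by rewrite !weightE /=; lia.
Qed.

Lemma nf_fuelE n w : (rank w < n)%N -> nf_fuel n w = nf_word w.
Proof. by move=> lt_n; apply: nf_fuel_indep. Qed.

Lemma nf_word_Var (a : Z) w :
  nf_word (Var a :: w) = << bvar a >> * nf_word w.
Proof.
rewrite -(@nf_fuelE (rank (Var a :: w)) w); first by [].
by apply: ltn_rank; rewrite weightE /=; lia.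
Qed.

Lemma nf_word_Br u w : ~~ head_bracket w ->
  nf_word (Br u :: w) = abrack (nf_word u) * nf_word w.
Proof.
move=> hw; rewrite -(@nf_fuelE (rank (Br u :: w)) u).
  rewrite -(@nf_fuelE (rank (Br u :: w)) w).
    by case: w hw => [|[a|//] w] hw.
all: by apply: ltn_rank; rewrite weightE /=; lia.
Qed.

Lemma nf_word_BrBr u v w :
  nf_word (Br u :: Br v :: w) =
    nf_word (Br (u ++ bbrack v) :: w) + nf_word (Br (Br u :: v) :: w)
    + lambda *: nf_word (u ++ v ++ w).
Proof.
pose n := rank (Br u :: Br v :: w).
rewrite -(@nf_fuelE n (Br (u ++ _) :: w)).
  rewrite -(@nf_fuelE n (Br (Br u :: v) :: w)).
    by rewrite -(@nf_fuelE n (u ++ v ++ w)) //;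
      apply: ltn_rank; rewrite !weightE /=; lia.
all: by apply: ltn_rank; rewrite !weightE /=; lia.
Qed.

End NormalWord.

HB.lock Definition nf (k : fieldType) (lambda : k) (Z : Type) :
    {malg k[bword Z]} -> {malg k[bword Z]} :=
  malg_lift (@nf_word k lambda Z).

Section NormalForm.
Variables (k : fieldType) (lambda : k) (Z : Type).
Local Notation A := {malg k[bword Z]}.
Local Notation rb := (rb lambda (@abrack k Z)).
Local Notation nf := (@nf k lambda Z).
Implicit Types (u v w : bword Z) (x y z : A).

Lemma nf_linear : linear nf.
Proof. by rewrite nf.unlock; exact: linearP. Qed.

HB.instance Definition _ := GRing.isLinear.Build k A A _ nf nf_linear.

Lemma nfU w : nf << w >> = nf_word lambda w.
Proof. by rewrite nf.unlock malg_liftU. Qed.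

Lemma nf1 : nf 1 = 1.
Proof. exact: nfU. Qed.

Lemma nf_Var (a : Z) x : nf ((<< bvar a >> : A) * x) = << bvar a >> * nf x.
Proof.
apply: (@malg_linear_eq _ _ _ (fun x => nf (_ * x)) (fun x => _ * nf x)).
- exact/linear_comp/malg_linear_mull/linear_id.
- exact/malg_linear_mull/linear_comp/linear_id.
by move=> w; rewrite monalgUM !nfU; exact: nf_word_Var.
Qed.

Lemma nf_Br x y :
  y \in kspan k (@no_head_bracket Z) -> nf (abrack x * y) = abrack (nf x) * nf y.
Proof.
move: y; apply: kspan_linear_eq.
- exact/linear_comp/malg_linear_mull/linear_id.
- exact/malg_linear_mull/linear_comp/linear_id.
move=> w hw.
apply: (@malg_linear_eq _ _ _ (fun x => nf (abrack x * _))
  (fun x => abrack (nf x) * _)).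
- exact/linear_comp/linear_mulr/linear_comp/linear_id.
- exact/linear_mulr/linear_comp/linear_comp/linear_id.
by move=> u; rewrite brackU monalgUM !nfU; exact: nf_word_Br.
Qed.

Lemma kspan_no_head1 : 1 \in kspan k (@no_head_bracket Z).
Proof. exact: kspan_word. Qed.

Lemma kspan_no_head_Var (a : Z) x :
  (<< bvar a >> : A) * x \in kspan k (@no_head_bracket Z).
Proof.
apply: (@kspan_mul _ _ [set bvar a] setT); last exact: mem_kspanT.
- by move=> _ v -> _.
- exact: kspan_word.
Qed.

Lemma nf_brack x : nf (abrack x) = abrack (nf x).
Proof. by rewrite -[abrack x]mulr1 nf_Br ?kspan_no_head1 // nf1 mulr1. Qed.

Lemma rb_wordE u v w :
  rb << u >> << v >> * << w >> =
    << Br (u ++ bbrack v) :: w >> + << Br (Br u :: v) :: w >>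
    + lambda *: << u ++ v ++ w >>.
Proof. by rewrite /rb !mulrDl -scalerAl -mulrA !(brackU, monalgUM). Qed.

Lemma nf_rb x y z : nf (abrack x * abrack y * z) = nf (rb x y * z).
Proof.
rewrite /rb.
apply: (@malg_linear_eq _ _ _ (fun z => nf (_ * z)) (fun z => nf (_ * z)))
  => {z} [||w]; try exact/linear_comp/malg_linear_mull/linear_id.
apply: (@malg_linear_eq _ _ _ (fun x => nf (abrack x * _ * _))
  (fun x => nf ((abrack (x * _) + abrack (abrack x * _) + _ *: (x * _)) * _)))
  => {x} [||u].
- exact/linear_comp/linear_mulr/linear_mulr/linear_comp/linear_id.
- apply/linear_comp/linear_mulr/linear_add; first apply/linear_add.
  + exact/linear_comp/linear_mulr/linear_id.
  + exact/linear_comp/linear_mulr/linear_comp/linear_id.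
  + exact/linear_scale/linear_mulr/linear_id.
apply: (@malg_linear_eq _ _ _ (fun y => nf (_ * abrack y * _))
  (fun y => nf ((abrack (_ * abrack y) + abrack (_ * y) + _ *: (_ * y)) * _)))
  => {y} [||v].
- exact/linear_comp/linear_mulr/malg_linear_mull/linear_comp/linear_id.
- apply/linear_comp/linear_mulr/linear_add; first apply/linear_add.
  + exact/linear_comp/malg_linear_mull/linear_comp/linear_id.
  + exact/linear_comp/malg_linear_mull/linear_id.
  + exact/linear_scale/malg_linear_mull/linear_id.
rewrite -/(rb _ _) rb_wordE !brackU !monalgUM !linearD linearZ /= !nfU.
exact: nf_word_BrBr.
Qed.

Lemma nf_BrBr u v w :
  nf << Br u :: Br v :: w >> =
    nf << Br (u ++ bbrack v) :: w >> + nf << Br (Br u :: v) :: w >>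
    + lambda *: nf << u ++ v ++ w >>.
Proof. by rewrite !nfU nf_word_BrBr. Qed.

Lemma kspan_no_head_word w :
  ~~ head_bracket w -> << w >> \in kspan k (@no_head_bracket Z).
Proof. exact: kspan_word. Qed.

(** Rewriting never increases the weight; this is the bound that [N_mull_word] relies on. *)
Lemma nf_weight w : nf << w >> \in kspan k [set v | (weight v <= weight w)%N].
Proof.
elim/rewriting_ind: w => [|a w IH|u w hw IHu IHw|u v w IH1 IH2 IH3].
- by rewrite nf1; exact: kspan_word.
- rewrite Var_consU nf_Var.
  apply: (@kspan_mul _ _ [set bvar a]) IH => [_ v -> /=|]; last exact: kspan_word.
  by rewrite !weightE.
- rewrite Br_consU nf_Br ?kspan_no_head_word //.
  apply: (@kspan_mul _ _ [set v | (weight v <= (weight u).+1)%N]) IHw.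
    by move=> v1 v2 /=; rewrite !weightE; lia.
  by apply: kspan_brack IHu => v /=; rewrite weightE.
- rewrite nf_BrBr; apply: rpredD; first apply: rpredD; last apply: rpredZ.
  + by move: IH1; apply: kspanS => t /=; rewrite !weightE /=; lia.
  + by move: IH2; apply: kspanS => t /=; rewrite !weightE /=; lia.
  + by move: IH3; apply: kspanS => t /=; rewrite !weightE /=; lia.
Qed.

Lemma nf_mul x y : nf (nf x * y) = nf (x * y) /\ nf (x * nf y) = nf (x * y).
Proof.
have scalerAr := @malg_scalerAr k (bword Z).
have e_cat u v : << u ++ v >> = (<< u >> : A) * << v >> by rewrite monalgUM.
have e_brack u : << bbrack u >> = abrack << u >> :> A by rewrite brackU.
have e_eq (f g : A -> A) (Lf : linear f) (Lg : linear g) := malg_linear_eq Lf Lg.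
have W_word n w : (weight w <= n)%N ->
    << w >> \in kspan k [set v | (weight v <= n)%N].
  exact: kspan_word.
have W_eq n (f g : A -> A) (Lf : linear f) (Lg : linear g) :=
  @kspan_linear_eq k Z [set v | (weight v <= n)%N] _ _ _ Lf Lg.
apply: (N_mul (e := fun w => << w >> : A) (X := fun a => << bvar a >> : A)
   (W := fun n => kspan k [set v | (weight v <= n)%N])
   (H := kspan k (@no_head_bracket Z)) (lambda := lambda) (B := @abrack k Z)) => //.
- exact: kspan_no_head1.
- exact: kspan_no_head_Var.
- exact: nf1.
- exact: nf_Var.
- exact: nf_Br.
- exact: nf_rb.
- exact: nf_weight.
Qed.

(** The second clause strengthens the induction: for [[u]w] to stay irreducible after normalising,
    the normal form of [w] must still not begin with a bracket. *)
Lemma nf_irr_word w :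
  nf << w >> \in kspan k (@mRB_irr Z) /\
  (~~ head_bracket w -> nf << w >> \in kspan k (@mRB_irr Z `&` @no_head_bracket Z)).
Proof.
elim/rewriting_ind: w
  => [|a w [IH _]|u w hw [IHu _] [_ /(_ hw) IHw]|u v w [IH1 _] [IH2 _] [IH3 _]].
- have nf1_irr : nf << [::] >> \in kspan k (@mRB_irr Z `&` @no_head_bracket Z).
    by rewrite nf1; apply: kspan_word; split=> //; exact: irr_nil.
  by split=> //; move: nf1_irr; apply: kspanS => w [].
- have nfa : nf << Var a :: w >> \in kspan k (@mRB_irr Z `&` @no_head_bracket Z).
    rewrite Var_consU nf_Var.
    apply: (@kspan_mul _ _ [set bvar a]) IH => [_ v -> iv|]; last exact: kspan_word.
    by split=> //; exact/irr_Var.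
  by split=> //; move: nfa; apply: kspanS => v [].
- split=> //; rewrite Br_consU nf_Br ?kspan_no_head_word //.
  apply: (@kspan_mul _ _ [set bbrack v | v in @mRB_irr Z]) IHw.
    by move=> _ v2 [v1 iv1 <-] [iv2 hv2]; apply/irr_Br.
  by apply: kspan_brack IHu => v iv; exists v.
- by split=> //; rewrite nf_BrBr !rpredD ?rpredZ.
Qed.

Lemma nf_irr x : nf x \in kspan k (@mRB_irr Z).
Proof.
apply: (kspan_linear_mem _ _ (mem_kspanT x)).
  exact/linear_comp/linear_id.
by move=> w _; case: (nf_irr_word w).
Qed.

Lemma nf_id x : x \in kspan k (@mRB_irr Z) -> nf x = x.
Proof.
move: x; apply: kspan_linear_eq => [||w].
- exact/linear_comp/linear_id.
- exact: linear_id.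
elim/rewriting_ind: w => [|a w IH|u w hw IHu IHw|u v w _ _ _] iw.
- exact: nf1.
- by rewrite Var_consU nf_Var IH //; apply: (irr_Var a w).1.
- have [iu iw' _] := (irr_Br _ _).1 iw.
  by rewrite Br_consU nf_Br ?kspan_no_head_word // IHu ?IHw.
- by have [] := (irr_Br _ _).1 iw.
Qed.

(** * The normal form map and the operated ideal *)

Local Notation Id := (opideal (@opi_instances k Z (mRB lambda))).

(** By minimality of the ideal it suffices that the kernel of [nf] is an operated ideal containing
    the instances; [nf_mul] makes it stable under products. *)
Lemma nf_opideal x : x \in Id -> nf x = 0.
Proof.
move=> /asboolP/(_ (fun x => nf x = 0)); apply; split; last first.
  move=> _ [u _ [v _ <-]]; rewrite mRB_subst -addrA -opprD -addrA -opprD linearB /=.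
  by rewrite -[abrack _ * abrack _]mulr1 nf_rb mulr1 /rb addrA subrr.
split=> [|x1 x2 Nx1 Nx2|a x1 Nx1|x1 Nx1].
- exact: linear0.
- by rewrite /= linearB /= Nx1 Nx2 subr0.
- by split; rewrite /= -?(nf_mul a x1).2 -?(nf_mul x1 a).1 Nx1 ?mulr0 ?mul0r linear0.
- by rewrite /= nf_brack Nx1 /abrack linear0.
Qed.

Lemma opideal_mul x y : x \in Id -> y * x \in Id /\ x * y \in Id.
Proof.
move=> /asboolP Ix; split; apply/asboolP => J [idJ SJ];
  by have [_ _ /(_ y x (Ix _ (conj idJ SJ)))[]] := idJ.
Qed.

Lemma opideal_brack x : x \in Id -> abrack x \in Id.
Proof.
move=> /asboolP Ix; apply/asboolP => J [idJ SJ].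
by have [_ _ _] := idJ; apply; exact: Ix.
Qed.

Lemma opideal_rb u v :
  abrack << u >> * abrack << v >> - rb << u >> << v >> \in Id.
Proof.
apply/asboolP => J [_]; apply; exists u => //; exists v => //.
by rewrite mRB_subst /rb !opprD !addrA.
Qed.

Lemma sub_nf x : x - nf x \in Id.
Proof.
apply: (kspan_linear_mem (f := fun x => x - nf x) _ _ (mem_kspanT x)) => [|w _].
  by move=> c y z; rewrite linearP scalerBr opprD addrACA.
elim/rewriting_ind: w => [|a w IH|u w hw IHu IHw|u v w IH1 IH2 IH3].
- by rewrite nf1 subrr rpred0.
- by rewrite Var_consU nf_Var -mulrBr; exact: (opideal_mul _ IH).1.
- rewrite Br_consU nf_Br ?kspan_no_head_word //.
  (* Change one factor at a time, so that each difference is covered by an induction hypothesis. *)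
  have -> : abrack << u >> * << w >> - abrack (nf << u >>) * nf << w >> =
      abrack (<< u >> - nf << u >>) * << w >>
      + abrack (nf << u >>) * (<< w >> - nf << w >>).
    by rewrite /abrack linearB mulrBl mulrBr addrA subrK.
  apply: rpredD; last exact: (opideal_mul _ IHw).1.
  exact/(opideal_mul _ _).2/opideal_brack.
- rewrite nf_BrBr (@Br_consU k Z u (Br v :: w)) (@Br_consU k Z v w) mulrA.
  (* Replacing the leading redex costs an instance of the identity times [<< w >>]; the three terms
     left match the induction hypotheses. *)
  rewrite -(subrK (rb << u >> << v >> * << w >>) (abrack << u >> * _ * _)).
  rewrite -mulrBl -addrA; apply: rpredD.
    exact: (opideal_mul _ (opideal_rb u v)).2.
  rewrite rb_wordE !opprD -scalerN addrACA -scalerDr addrACA.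
  by apply: rpredD; [exact: rpredD|exact: rpredZ].
Qed.

End NormalForm.

Local Open Scope quotient_scope.

Theorem corollary4p7 (k : fieldType) (lambda : k) (Z : Type) :
  let Id := opideal (@opi_instances k Z (mRB lambda)) in
  let kR := kspan k (@mRB_irr Z) in
  lmod_isomorphic (quot_lmod Id) (submod_type kR)
  /\ internal_direct_sum Id kR.
Proof.
move=> Id kR; split; last first.
  split=> [x|x Ix kx]; last by rewrite -(nf_id lambda kx); exact: nf_opideal.
  exists (x - nf lambda x); first exact: sub_nf.
  by exists (nf lambda x); [exact: nf_irr|rewrite subrK].
pose Q := quot_lmod Id.
have nf_pi x y : \pi_Q x = \pi_Q y -> nf lambda x = nf lambda y.
  move=> /eqP; rewrite -(Quotient.idealrBE (zmod_of Id)) => Ixy.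
  by apply/eqP; rewrite -subr_eq0 -linearB; apply/eqP; exact: nf_opideal Ixy.
(* The isomorphism normalises a chosen representative; [nf_pi] makes the choice irrelevant. Its
   inverse is the inclusion followed by the projection. *)
pose f (q : Q) : submod_type kR := Submod (nf_irr lambda (repr q)).
have f_lin : linear f.
  move=> c p q; apply: val_inj; rewrite /= -linearP.
  apply: nf_pi; rewrite reprK raddfD /=.
  by rewrite (pi_scale Id) !reprK.
pose F := GRing.isLinear.Build k Q (submod_type kR) _ f f_lin.
pose fL : {linear Q -> submod_type kR} := HB.pack f F.
exists fL; exists (fun y => \pi_Q (submod_val y)) => [q|y].
- rewrite -[RHS]reprK; apply/eqP; rewrite -(Quotient.idealrBE (zmod_of Id)) /=.
  by rewrite -opprB /zmod_of rpredN sub_nf.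
- apply: val_inj; rewrite /= -[RHS](nf_id lambda (submod_valP y)).
  by apply: nf_pi; rewrite reprK.
Qed.
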